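(* Christoffel and Darboux transforms commute. That is: let $f:(M,Q)\to\mathbb{R}^n$ be isothermic with Christoffel transform $f^c$, let $r\in\mathbb{R}\setminus\{0\}$ and let $\hat f=f+g=\mathcal{D}_rf$ be a Darboux transform of $f$. Then $f^c+(rg)^{-1}$ is a Darboux transform $\mathcal{D}_rf^c$ of $f^c$ and coincides, up to translation, with the Christoffel transform $\hat f^c$ of $\hat f$.
   Context: $C\ell_n$ is the real Clifford algebra of Euclidean $\mathbb{R}^n$, with $vw+wv=-2(v,w)1$; nonzero vectors are invertible. For $C\ell_n$-valued 1-forms, $(\alpha\wedge\beta)(X,Y)=\alpha(X)\beta(Y)-\alpha(Y)\beta(X)$. A polarised Riemann surface $(M,Q)$ is a Riemann surface $M$ with a nonzero holomorphic quadratic differential $Q$. For $\mathbb{R}^n$-valued 1-forms, $(\alpha,\beta)^{2,0}=(\alpha(\partial_z),\beta(\partial_z))\,dz^2$. A conformal immersion $f:(M,Q)\to\mathbb{R}^n$ is isothermic if there is a map $f^c:M\to\mathbb{R}^n$ with $df\wedge df^c=0$ and $(df,df^c)^{2,0}=Q$; $f^c$ is unique up to translation and called the Christoffel transform of $f$; away from zeros of $Q$, $f^c$ is itself isothermic on $(M,Q)$ with Christoffel transform $f$. For $r\in\mathbb{R}\setminus\{0\}$, $\mathcal{D}_rf$ denotes any map $f+g$ where $g:M\to\mathbb{R}^n$ is a (nowhere zero) solution of $dg=r\,g\,df^c\,g-df$ (products in $C\ell_n$). Correspondingly, $\mathcal{D}_rf^c$ denotes any $f^c+k$ with $dk=r\,k\,df\,k-df^c$.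 Statements are local and considered away from zeros of $Q$ where immersions are required. *)

(* Defs.v *)
From HB Require Import structures.
From mathcomp Require Import all_boot all_order all_algebra all_field.
From mathcomp Require Import complex.
From mathcomp Require Import all_classical all_reals all_analysis.
From mathcomp Require Import ring.

Set Implicit Arguments.
Unset Strict Implicit.
Unset Printing Implicit Defensive.

Import Order.TTheory GRing.Theory Num.Theory.
Import numFieldNormedType.Exports.

Local Open Scope classical_set_scope.
Local Open Scope ring_scope.

Definition dot (S : comNzRingType) (n : nat) (v w : 'rV[S]_n) : S :=
  \sum_(i < n) v 0 i * w 0 i.

Section SetBlades.
Variables (R : fieldType) (n : nat).
Implicit Types A B C D : {set 'I_n}.

Definition symdiff A B : {set 'I_n} := (A :\: B) :|: (B :\: A).

(* The sign in e_A e_B = sign * e_(A symdiff B), where e_A is the increasing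
   product of the e_i with i in A: sorting contributes one factor -1 for each
   pair with j < i, and e_i e_i = -1 contributes one for each pair j = i.      *)
Definition blade_sign A B : R :=
  \prod_(i in A) \prod_(j in B | (j <= i)%N) -1.

Lemma in_symdiff A B i : (i \in symdiff A B) = (i \in A) (+) (i \in B).
Proof. by rewrite !inE; case: (i \in A); case: (i \in B). Qed.

Lemma symdiffA A B C : symdiff A (symdiff B C) = symdiff (symdiff A B) C.
Proof. by apply/setP=> i; rewrite !in_symdiff addbA. Qed.

Lemma symdiffC A B : symdiff A B = symdiff B A.
Proof. by apply/setP=> i; rewrite !in_symdiff addbC. Qed.

Lemma symdiff0 A : symdiff A finset.set0 = A.
Proof. by apply/setP=> i; rewrite in_symdiff inE addbF. Qed.

Lemma sym0diff A : symdiff finset.set0 A = A.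
Proof. by rewrite symdiffC symdiff0. Qed.

Lemma symdiffv A : symdiff A A = finset.set0.
Proof. by apply/setP=> i; rewrite in_symdiff addbb inE. Qed.

Lemma symdiffK A : cancel (symdiff A) (symdiff A).
Proof. by move=> B; rewrite symdiffA symdiffv sym0diff. Qed.

Lemma symdiff_eq0 A B : (symdiff A B == finset.set0) = (A == B).
Proof.
apply/eqP/eqP=> [AB0|->]; last exact: symdiffv.
by rewrite -[RHS](symdiffK A) AB0 symdiff0.
Qed.

Lemma blade_signE A B :
  blade_sign A B =
  \prod_(i < n) \prod_(j < n | (j <= i)%N) (-1) ^+ ((i \in A) && (j \in B)).
Proof.
rewrite /blade_sign big_mkcond; apply: eq_bigr => i _.
case: (i \in A) => /=; last by rewrite big1.
by rewrite big_mkcondl; apply: eq_bigr => j _; case: (j \in B).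
Qed.

Lemma blade_signDl A B D :
  blade_sign (symdiff A B) D = blade_sign A D * blade_sign B D.
Proof.
rewrite !blade_signE -big_split /=; apply: eq_bigr => i _.
rewrite -big_split /=; apply: eq_bigr => j _.
by rewrite in_symdiff andb_addl signr_addb.
Qed.

Lemma blade_signDr A B D :
  blade_sign A (symdiff B D) = blade_sign A B * blade_sign A D.
Proof.
rewrite !blade_signE -big_split /=; apply: eq_bigr => i _.
rewrite -big_split /=; apply: eq_bigr => j _.
by rewrite in_symdiff andb_addr signr_addb.
Qed.

Lemma blade_sign0l A : blade_sign finset.set0 A = 1.
Proof. by rewrite blade_signE big1 // => i _; rewrite big1 // => j; rewrite inE. Qed.

Lemma blade_sign0r A : blade_sign A finset.set0 = 1.
Proof.
by rewrite blade_signE big1 // => i _; rewrite big1 // => j; rewrite inE andbF.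
Qed.

Lemma blade_sign_sq A B : blade_sign A B * blade_sign A B = 1.
Proof. by rewrite -blade_signDl symdiffv blade_sign0l. Qed.

End SetBlades.

(* The Clifford algebra as the vector space with basis (e_A), A subset of
   {0, ..., n-1}; the value at A is the coordinate along e_A.                  *)
Definition clifford (R : fieldType) (n : nat) : Type := {ffun {set 'I_n} -> R^o}.

Section Clifford.
Variables (R : fieldType) (n : nat).
Local Notation Cl := (clifford R n).

HB.instance Definition _ := Vector.copy Cl {ffun {set 'I_n} -> R^o}.

Definition blade (A : {set 'I_n}) : Cl := [ffun B => (B == A)%:R].

Definition clifford_mul (x y : Cl) : Cl :=
  [ffun C => \sum_A blade_sign R A (symdiff A C) * (x A * y (symdiff A C))].

Lemma clifford_mulA : associative clifford_mul.
Proof.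
move=> x y z; apply/ffunP=> C; rewrite !ffunE.
under eq_bigr do rewrite ffunE 2!mulr_sumr.
under [RHS]eq_bigr do rewrite ffunE mulr_suml mulr_sumr.
rewrite [RHS]exchange_big /=; apply: eq_bigr => A _.
rewrite [RHS](reindex_inj (can_inj (symdiffK A))) /=.
apply: eq_bigr => D _; rewrite symdiffK.
have -> : symdiff D (symdiff A C) = symdiff (symdiff A D) C.
  by rewrite symdiffA (symdiffC D).
rewrite -[LHS]mul1r -(blade_sign_sq R A D) !blade_signDr !blade_signDl.
by ring.
Qed.

Lemma blade_mull1 : left_id (blade finset.set0) clifford_mul.
Proof.
move=> x; apply/ffunP=> C; rewrite ffunE (bigD1 finset.set0) //= big1 => [|A A0].
  by rewrite addr0 ffunE eqxx mul1r sym0diff blade_sign0l mul1r.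
by rewrite ffunE (negbTE A0) mul0r mulr0.
Qed.

Lemma blade_mulr1 : right_id (blade finset.set0) clifford_mul.
Proof.
move=> x; apply/ffunP=> C; rewrite ffunE (bigD1 C) //= big1 => [|A AC].
  by rewrite addr0 ffunE symdiffv eqxx mulr1 blade_sign0r mul1r.
by rewrite [blade _ _]ffunE symdiff_eq0 (negbTE AC) !mulr0.
Qed.

Lemma clifford_mulDl : left_distributive clifford_mul +%R.
Proof.
move=> x y z; apply/ffunP=> C; rewrite !ffunE -big_split /=.
by apply: eq_bigr => A _; rewrite ffunE mulrDl mulrDr.
Qed.

Lemma clifford_mulDr : right_distributive clifford_mul +%R.
Proof.
move=> x y z; apply/ffunP=> C; rewrite !ffunE -big_split /=.
by apply: eq_bigr => A _; rewrite ffunE 2!mulrDr.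
Qed.

Lemma blade0_neq0 : blade finset.set0 != 0.
Proof.
by apply/eqP=> /ffunP/(_ finset.set0)/eqP; rewrite !ffunE eqxx oner_eq0.
Qed.

HB.instance Definition _ := GRing.Zmodule_isNzRing.Build Cl
  clifford_mulA blade_mull1 blade_mulr1 clifford_mulDl clifford_mulDr blade0_neq0.

Lemma clifford_scaleAl (a : R) (x y : Cl) : a *: (x * y) = (a *: x) * y.
Proof.
apply/ffunP=> C; rewrite !ffunE scaler_sumr; apply: eq_bigr => A _.
by rewrite ffunE /GRing.scale /=; ring.
Qed.

Lemma clifford_scaleAr (a : R) (x y : Cl) : a *: (x * y) = x * (a *: y).
Proof.
apply/ffunP=> C; rewrite !ffunE scaler_sumr; apply: eq_bigr => A _.
by rewrite ffunE /GRing.scale /=; ring.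
Qed.

HB.instance Definition _ := GRing.Lmodule_isLalgebra.Build R Cl clifford_scaleAl.
HB.instance Definition _ := GRing.Lalgebra_isAlgebra.Build R Cl clifford_scaleAr.
HB.instance Definition _ := Algebra_isFalgebra.Build R Cl.

Definition cvec (v : 'rV[R]_n) : Cl := \sum_(i < n) v 0 i *: blade [set i].

Lemma bladeM (A B : {set 'I_n}) :
  blade A * blade B = blade_sign R A B *: blade (symdiff A B).
Proof.
apply/ffunP=> C; rewrite [LHS]ffunE (bigD1 A) //= big1 => [|D DA]; last first.
  by rewrite [blade A _]ffunE (negbTE DA) mul0r mulr0.
rewrite addr0 !ffunE eqxx mul1r (can2_eq (symdiffK A) (symdiffK A)).
by case: eqP => [->|_]; rewrite ?symdiffK // mulr0 scaler0.
Qed.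

Lemma blade_sign11 (i j : 'I_n) :
  blade_sign R [set i] [set j] = if (j <= i)%N then -1 else 1.
Proof. by rewrite /blade_sign big_set1 big_mkcondr big_set1. Qed.

Lemma blade_anticomm (i j : 'I_n) :
  blade [set i] * blade [set j] + blade [set j] * blade [set i] =
  (- 2 * (i == j)%:R) *: (1 : Cl).
Proof.
rewrite !bladeM !blade_sign11 (symdiffC [set j]) -scalerDl.
case: (ltngtP (i : nat) j) => [ij|ij|/val_inj ->].
- by rewrite subrr (ltn_eqF ij : (i == j) = false) mulr0 !scale0r.
- by rewrite addNr (gtn_eqF ij : (i == j) = false) mulr0 !scale0r.
- by rewrite eqxx symdiffv mulr1; congr (_ *: _); ring.
Qed.

Lemma cvecM (v w : 'rV[R]_n) :
  cvec v * cvec w + cvec w * cvec v = (- 2 * dot v w) *: (1 : Cl).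
Proof.
have E (x y : 'rV[R]_n) : cvec x * cvec y =
    \sum_(i < n) \sum_(j < n) (x 0 i * y 0 j) *: (blade [set i] * blade [set j]).
  rewrite /cvec mulr_suml; apply: eq_bigr => i _; rewrite mulr_sumr.
  by apply: eq_bigr => j _; rewrite -scalerAl -scalerAr scalerA.
rewrite !E [X in _ + X]exchange_big -big_split /= /dot mulr_sumr scaler_suml.
apply: eq_bigr => i _; rewrite -big_split /= (bigD1 i) //= big1 => [|j ji].
  by rewrite addr0 [w 0 i * _]mulrC -scalerDr blade_anticomm eqxx scalerA mulr1 [in LHS]mulrC.
rewrite [w 0 j * _]mulrC -scalerDr blade_anticomm eq_sym (negbTE ji).
by rewrite mulr0 scale0r scaler0.
Qed.

End Clifford.

Lemma cvec_inv (R : realFieldType) (n : nat) (v : 'rV[R]_n) : v != 0 ->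
  cvec v \is a GRing.unit /\ (cvec v)^-1 = - (dot v v)^-1 *: cvec v.
Proof.
move=> v0; have vv0 : dot v v != 0.
  apply: contraNneq v0 => /eqP; rewrite psumr_eq0 => [/allP vv0|i _]; last first.
    by rewrite -expr2 sqr_ge0.
  apply/eqP/rowP=> i; rewrite mxE; apply/eqP.
  by have := vv0 i (mem_index_enum _); rewrite /= mulf_eq0 orbb.
have sq : cvec v * cvec v = - dot v v *: 1.
  apply: (@scalerI _ _ 2); first by rewrite pnatr_eq0.
  by rewrite scaler_nat mulr2n cvecM scalerA mulrN mulNr.
have vK : cvec v * (- (dot v v)^-1 *: cvec v) = 1.
  by rewrite -scalerAr sq scalerA mulrNN mulVf // scale1r.
have Kv : (- (dot v v)^-1 *: cvec v) * cvec v = 1.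
  by rewrite -scalerAl sq scalerA mulrNN mulVf // scale1r.
have vU : cvec v \is a GRing.unit by apply/unitrP; exists (- (dot v v)^-1 *: cvec v).
by split=> //; apply: (mulrI vU); rewrite vK divrr.
Qed.

Local Notation Cplx R := (R[i]%C^o).

Definition plane (R : realType) (z : R * R) : Cplx R := (z.1 +i* z.2)%C.

Record chart (R : realType) (T : topologicalType) := Chart {
  dom : set T;
  coord : T -> Cplx R;
  param : Cplx R -> T }.

Definition is_chart (R : realType) (T : topologicalType) (c : chart R T) :=
  [/\ open (dom c),
      open (coord c @` dom c),
      {within dom c, continuous (coord c)},
      {within coord c @` dom c, continuous (param c)} &
      forall p, dom c p -> param c (coord c p) = p].

Definition transition (R : realType) (T : topologicalType) (c c' : chart R T) :
  Cplx R -> Cplx R := coord c' \o param c.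

Definition holomorphic_on (R : realType) (A : set (Cplx R)) (h : Cplx R -> Cplx R) :=
  forall z, A z -> derivable h z 1.

(* Second countability is automatic (Rado).                                   *)
Record riemann_surface (R : realType) := RiemannSurface {
  surface :> topologicalType;
  atlas : set (chart R surface);
  surface_connected : connected [set: surface];
  surface_hausdorff : hausdorff_space surface;
  atlas_chart : forall c, atlas c -> is_chart c;
  atlas_cover : forall p, exists2 c, atlas c & dom c p;
  atlas_holomorphic : forall c c', atlas c -> atlas c' ->
    holomorphic_on (coord c @` (dom c `&` dom c')) (transition c c') }.

(* [qcoef c] is the coefficient q of Q = q dz^2 in the chart c.               *)
Record quadratic_differential (R : realType) (M : riemann_surface R) :=
  QuadraticDifferential {
    qcoef : chart R M -> Cplx R -> Cplx R;
    qcoef_holomorphic : forall c, atlas c ->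
      holomorphic_on (coord c @` dom c) (qcoef c);
    qcoef_transition : forall c c' p, atlas c -> atlas c' ->
      dom c p -> dom c' p ->
      qcoef c (coord c p) =
      qcoef c' (coord c' p) * ('D_1 (transition c c') (coord c p)) ^+ 2 }.

Section Surfaces.
Variables (R : realType) (M : riemann_surface R) (n : nat).
Implicit Types (Q : quadratic_differential M) (W : set M) (c : chart R M).
Implicit Types (f fc g : M -> 'rV[R]_n) (p : M) (r : R).

Definition nonvanishing Q : set M :=
  [set p | forall c, atlas c -> dom c p -> qcoef Q c (coord c p) != 0].

Definition qnonzero Q :=
  exists c p, [/\ atlas c, dom c p & qcoef Q c (coord c p) != 0].

Definition local c f : R * R -> 'rV[R]_n := f \o param c \o @plane R.

Definition xy c p : R * R := (complex.Re (coord c p), complex.Im (coord c p)).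

(* The differential of f at p, on tangent vectors X = (X.1, X.2) standing for
   X.1 d/dx + X.2 d/dy in the chart c.                                        *)
Definition diff_at c f p : R * R -> 'rV[R]_n := 'd (local c f) (xy c p).

(* C^infinity on an open set W: all iterated directional derivatives in charts
   are differentiable.                                                         *)
Definition smooth_on W f :=
  forall c, atlas c -> forall (vs : seq (R * R)) p, dom c p -> W p ->
  differentiable (foldr (fun v (F : R * R -> 'rV[R]_n) => 'D_v F) (local c f) vs)
    (xy c p).

Definition conformal_immersion_on W f :=
  smooth_on W f /\
  forall c p, atlas c -> dom c p -> W p ->
    injective (diff_at c f p) /\
    exists lambda : R, forall X Y,
      dot (diff_at c f p X) (diff_at c f p Y) =
      lambda * (X.1 * Y.1 + X.2 * Y.2).

Definition wedge (alpha beta : R * R -> clifford R n) (X Y : R * R) :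
  clifford R n := alpha X * beta Y - alpha Y * beta X.

(* alpha(d/dz), with d/dz = (d/dx - i d/dy) / 2 *)
Definition at_dz (alpha : R * R -> 'rV[R]_n) : 'rV[R[i]%C]_n :=
  \row_j ((alpha (1, 0) 0 j +i* - alpha (0, 1) 0 j)%C / 2).

(* the coefficient of dz^2 in (alpha, beta)^{2,0} *)
Definition part20 (alpha beta : R * R -> 'rV[R]_n) : R[i]%C :=
  dot (at_dz alpha) (at_dz beta).

Definition christoffel_pair_on Q W f fc :=
  smooth_on W fc /\
  forall c p, atlas c -> dom c p -> W p ->
    (forall X Y,
       wedge (@cvec R n \o diff_at c f p) (@cvec R n \o diff_at c fc p) X Y = 0) /\
    part20 (diff_at c f p) (diff_at c fc p) = qcoef Q c (coord c p).

Definition isothermic_on Q W f :=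
  conformal_immersion_on W f /\ exists fc, christoffel_pair_on Q W f fc.

Definition darboux_solution r f fc g :=
  [/\ smooth_on setT g,
      forall p, g p != 0 &
      forall c p X, atlas c -> dom c p ->
        cvec (diff_at c g p X) =
        r *: (cvec (g p) * cvec (diff_at c fc p X) * cvec (g p)) -
        cvec (diff_at c f p X)].

Definition darboux_transform r f fc fhat :=
  exists2 g, darboux_solution r f fc g & forall p, fhat p = f p + g p.

End Surfaces.

(* Main.v *)
Require Import Defs.
From HB Require Import structures.
From mathcomp Require Import all_boot all_order all_algebra all_field.
From mathcomp Require Import complex.
From mathcomp Require Import all_classical all_reals all_analysis.
From mathcomp Require Import ring lra.

Set Implicit Arguments.
Unset Strict Implicit.
Unset Printing Implicit Defensive.

Import Order.TTheory GRing.Theory Num.Theory.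
Import numFieldNormedType.Exports.

Local Open Scope classical_set_scope.
Local Open Scope ring_scope.

(* For v in R^n the product g v g is |g|^2 v - 2 (g, v) g, again a vector, and
   v |-> g v g scales the inner product by |g|^4. The Riccati equation of g
   reads d(fhat) = r g dfc g, and that of k = (r g)^-1 follows from it, giving
   dh = r^-1 g^-1 df g^-1 for h = fc + k. Hence (fhat, h) satisfies both
   Christoffel equations because (f, fc) does.
     If a, b are the partial derivatives of a conformal f, |a|^2 = |b|^2 = l,
   then df /\ dfc = 0 forces the partial derivatives of fc to be
   (s a + m b) / l and (m a - s b) / l, where (s - i m) / 2 is the dz^2
   coefficient of (df, dfc)^{2,0}. So fc is conformal, immersed where Q is
   nonzero, and its differential is determined by f and Q. *)

(** * Bilinearity and definiteness of the inner product *)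

Section Dot.
Variables (S : comNzRingType) (n : nat).
Implicit Types (u v w : 'rV[S]_n) (a : S).

Lemma dotC v w : dot v w = dot w v.
Proof. by apply: eq_bigr => i _; rewrite mulrC. Qed.

Lemma dotDl u v w : dot (u + v) w = dot u w + dot v w.
Proof. by rewrite /dot -big_split; apply: eq_bigr => i _; rewrite mxE mulrDl. Qed.

Lemma dotZl a v w : dot (a *: v) w = a * dot v w.
Proof. by rewrite /dot mulr_sumr; apply: eq_bigr => i _; rewrite mxE mulrA. Qed.

Lemma dotDr u v w : dot u (v + w) = dot u v + dot u w.
Proof. by rewrite dotC dotDl !(dotC u). Qed.

Lemma dotZr a v w : dot v (a *: w) = a * dot v w.
Proof. by rewrite dotC dotZl dotC. Qed.

Lemma dotNl v w : dot (- v) w = - dot v w.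
Proof. by rewrite -scaleN1r dotZl mulN1r. Qed.

Lemma dotNr v w : dot v (- w) = - dot v w.
Proof. by rewrite dotC dotNl dotC. Qed.

Lemma dotBl u v w : dot (u - v) w = dot u w - dot v w.
Proof. by rewrite dotDl dotNl. Qed.

Lemma dotBr u v w : dot u (v - w) = dot u v - dot u w.
Proof. by rewrite dotDr dotNr. Qed.

Lemma dot0l v : dot 0 v = 0.
Proof. by rewrite -[0 in LHS](scale0r v) dotZl mul0r. Qed.

End Dot.

Lemma dot_eq0 (R : realDomainType) (n : nat) (v : 'rV[R]_n) :
  (dot v v == 0) = (v == 0).
Proof.
apply/idP/eqP => [|->]; last by rewrite dot0l.
rewrite psumr_eq0 => [/allP vv0|i _]; last by rewrite -expr2 sqr_ge0.
apply/rowP=> i; rewrite mxE; apply/eqP.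
by have := vv0 i (mem_index_enum _); rewrite /= mulf_eq0 orbb.
Qed.

(** * Products of vectors in the Clifford algebra and the map v |-> g v g *)

Section CliffordVectors.
Variables (R : realFieldType) (n : nat).
Implicit Types (a b u v w g : 'rV[R]_n).
Local Notation cv := (@cvec R n).

Lemma cvecD v w : cv (v + w) = cv v + cv w.
Proof.
by rewrite /cvec -big_split; apply: eq_bigr => i _; rewrite mxE scalerDl.
Qed.

Lemma cvecZ (k : R) v : cv (k *: v) = k *: cv v.
Proof.
by rewrite /cvec scaler_sumr; apply: eq_bigr => i _; rewrite mxE scalerA.
Qed.

Lemma cvecN v : cv (- v) = - cv v.
Proof. by rewrite -scaleN1r cvecZ scaleN1r. Qed.

Lemma cvecB v w : cv (v - w) = cv v - cv w.
Proof. by rewrite cvecD cvecN. Qed.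

Lemma cvec_coord v i : cv v [set i]%SET = v 0 i.
Proof.
rewrite /cvec sum_ffunE (bigD1 i) //= big1 => [|j ji].
  by rewrite !ffunE eqxx /GRing.scale /= mulr1 addr0.
rewrite !ffunE (inj_eq finset.set1_inj) eq_sym (negbTE ji).
by rewrite /GRing.scale /= mulr0.
Qed.

Lemma cvec_inj : injective cv.
Proof. by move=> v w vw; apply/rowP => i; rewrite -!cvec_coord vw. Qed.

(** Only the products e_i e_i = -1 contribute to the empty blade, since e_i e_j with distinct i, j
    is a multiple of a blade of size two. *)
Lemma cvecM_scalar v w : (cv v * cv w) finset.set0 = - dot v w.
Proof.
rewrite /cvec mulr_suml sum_ffunE /dot -sumrN; apply: eq_bigr => i _.
rewrite mulr_sumr sum_ffunE (bigD1 i) //= big1 => [|j ji].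
  rewrite -scalerAl -scalerAr scalerA bladeM symdiffv !ffunE eqxx blade_sign11.
  by rewrite leqnn /GRing.scale /= mulr1 mulrN1 addr0.
rewrite -scalerAl -scalerAr scalerA bladeM !ffunE [in X in X%:R]eq_sym symdiff_eq0.
by rewrite (inj_eq finset.set1_inj) eq_sym (negbTE ji) /GRing.scale /= !mulr0.
Qed.

Lemma cvecM_anticomm v w : cv v * cv w = (- 2 * dot v w) *: 1 - cv w * cv v.
Proof. by rewrite -cvecM addrK. Qed.

Lemma cvecM_eq_dot v w v' w' :
  cv v * cv w = cv v' * cv w' -> dot v w = dot v' w'.
Proof.
move=> /(congr1 (fun x : clifford R n => x finset.set0)).
by rewrite !cvecM_scalar => /oppr_inj.
Qed.

(* The scalar part of v w = v' w' is (v, w) = (v', w'), and w v is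
   -2 (v, w) - v w. *)
Lemma cvecM_rev v w v' w' :
  cv v * cv w = cv v' * cv w' -> cv w * cv v = cv w' * cv v'.
Proof.
move=> E; rewrite cvecM_anticomm [RHS]cvecM_anticomm E.
by rewrite (dotC w) (dotC w') (cvecM_eq_dot E).
Qed.

(** For nonzero g this is |g|^2 times the reflection in the hyperplane orthogonal to g; in the
    Clifford algebra it is g v g. *)
Definition refl g v := dot g g *: v - (2 * dot g v) *: g.

Lemma reflZ (k : R) g v : refl g (k *: v) = k *: refl g v.
Proof. by apply/rowP=> i; rewrite !mxE dotZr; ring. Qed.

Lemma reflZl (k : R) g v : refl (k *: g) v = k ^+ 2 *: refl g v.
Proof. by apply/rowP=> i; rewrite !mxE !dotZl dotZr; ring. Qed.

Lemma refl_linear g : linear (refl g).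
Proof. by move=> k v w; apply/rowP=> i; rewrite !mxE dotDr dotZr; ring. Qed.

Lemma dot_refl g v w : dot (refl g v) (refl g w) = dot g g ^+ 2 * dot v w.
Proof.
rewrite /refl !(dotBl, dotBr, dotZl, dotZr) (dotC v g).
by rewrite /=; ring.
Qed.

Lemma reflK g v : refl g (refl g v) = dot g g ^+ 2 *: v.
Proof.
apply/rowP=> i; rewrite /refl !mxE !(dotBr, dotZr).
by rewrite /=; ring.
Qed.

Lemma cvec_sq v : cv v * cv v = - dot v v *: 1.
Proof.
apply: (@scalerI _ _ 2); first by rewrite pnatr_eq0.
by rewrite scaler_nat mulr2n cvecM scalerA mulrN mulNr.
Qed.

Lemma cvec_refl g v : cv (refl g v) = cv g * cv v * cv g.
Proof.
rewrite cvecM_anticomm mulrBl -scalerAl mul1r -mulrA cvec_sq -scalerAr mulr1.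
by rewrite /refl cvecB !cvecZ scaleNr opprK mulNr scaleNr addrC.
Qed.

(** The inner factor g g of (g v g)(g w g) collapses to -|g|^2. Equations between products of two
    vectors therefore pass through [refl g]. *)
Lemma cvecM_refl g v w :
  cv (refl g v) * cv (refl g w) = - dot g g *: (cv g * (cv v * cv w) * cv g).
Proof.
rewrite !cvec_refl !mulrA -(mulrA (cv g * cv v)) cvec_sq -scalerAr mulr1.
by rewrite -!scalerAl ?mulrA.
Qed.

(* Comparing a d2 a with b d1 a moves the Clifford identity into R^n. *)
Lemma conformal_wedge0 (l : R) a b d1 d2 :
    l != 0 -> dot a a = l -> dot b b = l -> dot a b = 0 ->
    cv a * cv d2 = cv b * cv d1 ->
  l *: d1 = dot a d1 *: a + dot a d2 *: b /\
  l *: d2 = dot a d2 *: a - dot a d1 *: b.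
Proof.
move=> l0.
have main a' b' e1 e2 : dot a' a' = l -> dot a' b' = 0 ->
    cv a' * cv e2 = cv b' * cv e1 ->
    l *: e2 = dot a' e2 *: a' - dot a' e1 *: b'.
  move=> aa ab E.
  (* By [E], a' e2 a' = b' e1 a'. Moving a' to the left past e1 and b' gives -2 (a', e1) b' + a' b'
     e1, and a' b' e1 = a' a' e2 = -l e2. *)
  have /rowP H : refl a' e2 = (- 2 * dot a' e1) *: b' - l *: e2.
    apply: cvec_inj; rewrite cvec_refl E cvecB !cvecZ.
    rewrite -mulrA (cvecM_anticomm e1) (dotC e1) mulrBr mulrA.
    rewrite (cvecM_anticomm b' a') (dotC b') ab mulr0 scale0r sub0r.
    rewrite (mulNr (_ * _)) opprK -mulrA -E (mulrA (cv a')) cvec_sq aa.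
    by rewrite -scalerAl mul1r -scalerAr mulr1 scaleNr.
  apply/rowP=> i; apply: (@mulfI _ 2); first by rewrite pnatr_eq0.
  have := H i; rewrite !mxE aa => {}H.
  have -> : 2 * (l * e2 0 i) = l * e2 0 i -
      (- 2 * dot a' e1 * b' 0 i - l * e2 0 i) - 2 * dot a' e1 * b' 0 i by ring.
  by rewrite -H; ring.
move=> aa bb ab E.
have ld2 := main a b d1 d2 aa ab E.
(* The hypotheses are symmetric under exchanging a with b and d1 with d2. The scalar part of [E]
   then replaces (b, d1) by (a, d2), and pairing with a replaces (b, d2) by -(a, d1). *)
have := main b a d2 d1 bb; rewrite dotC -E => /(_ ab erefl).
rewrite -(cvecM_eq_dot E) => ld1; split=> //.
suff -> : dot a d1 = - dot b d2 by rewrite ld1 scaleNr addrC.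
apply: (mulfI l0); rewrite -dotZr ld1 dotBr !dotZr ab aa.
by ring.
Qed.

End CliffordVectors.

(** * Smooth maps on an open subset of a normed space *)

Section SmoothFunctions.
Variables (R : realType) (E : normedModType R).

Definition iter_derive (V : normedModType R) (F : E -> V) (vs : seq E) : E -> V :=
  foldr (fun v (G : E -> V) => 'D_v G) F vs.

Definition smooth (V : normedModType R) (U : set E) (F : E -> V) :=
  forall vs z, U z -> differentiable (iter_derive F vs) z.

Variables (U : set E) (Uopen : open U).

Let nearU (V : normedModType R) (F G : E -> V) z :
  (forall z, U z -> F z = G z) -> U z -> \forall w \near z, F w = G w.
Proof.
by move=> FG Uz; apply: filterS (open_nbhs_nbhs (conj Uopen Uz)) => w /FG.
Qed.

(** [G - F] vanishes near [z], so it is differentiable there with differential 0, and [G] is its sum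
    with [F]. *)
Lemma near_eq_differentiable (V : normedModType R) (F G : E -> V) z :
  (\forall w \near z, F w = G w) -> differentiable F z -> differentiable G z.
Proof.
move=> FG dF.
have cont0 : continuous (0 : E -> V) by exact: cst_continuous.
have E0 : (G - F) \o shift z = cst ((G - F) z) + (0 : E -> V) +o_ 0 id.
  have FG0 : \forall h \near (0 : E), F (h + z) = G (h + z).
    rewrite (near_shift z) /=; near=> w; rewrite /= sub0r addrNK; near: w.
    exact: FG.
  apply/(@eqaddoP R) => _/posnumP[e]; near=> h.
  rewrite /= !fctE /= addr0.
  have FGz : F z = G z by exact: nbhs_singleton FG.
  have FGh : F (h + z) = G (h + z) by near: h.
  by rewrite FGz FGh !subrr normr0 mulr_ge0 //.
have d0 : 'd (G - F) z = (0 : E -> V) :> (E -> V).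
  pose L : {linear E -> V} := \0.
  exact: (@diff_unique _ _ _ _ L).
rewrite -(subrK F G); apply: differentiableD => //.
by apply/diff_locallyP; rewrite d0.
Unshelve. all: by end_near. Qed.

(* Working with the whole class P avoids Leibniz formulas for iterated
   derivatives. *)
Lemma smooth_coind (V : normedModType R) (P : (E -> V) -> Prop) :
  (forall F, P F -> forall z, U z -> differentiable F z) ->
  (forall F v, P F -> exists2 G, P G & forall z, U z -> 'D_v F z = G z) ->
  forall F, P F -> smooth U F.
Proof.
move=> dP DP F PF vs.
(* The class is closed under derivation only up to equality on [U], hence the generalisation to [G].
   The fold applies the last vector first, hence the induction from the right end of [vs]. *)
suff: forall G, (forall z, U z -> F z = G z) ->
    forall z, U z -> differentiable (iter_derive G vs) z by apply.
elim/last_ind: vs F PF => [|vs v IH] F PF G FG z Uz.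
  exact: near_eq_differentiable (nearU FG Uz) (dP _ PF _ Uz).
rewrite /iter_derive foldr_rcons; have [H PH FH] := DP F v PF.
apply: IH PH _ _ _ Uz => w Uw; rewrite -FH //.
exact: near_eq_derive (nearU FG Uw).
Qed.

Lemma smooth_differentiable (V : normedModType R) (F : E -> V) z :
  smooth U F -> U z -> differentiable F z.
Proof. exact: (fun sF => sF [::] z). Qed.

Lemma smooth_derive (V : normedModType R) (F : E -> V) v :
  smooth U F -> smooth U ('D_v F).
Proof.
by move=> sF vs z; have := sF (rcons vs v) z; rewrite /iter_derive foldr_rcons.
Qed.

(** A class suited to [smooth_coind]: the sum, product and inverse rules express the derivative of a
    member by the same operations applied to members. *)
Inductive smooth_closure : (E -> R) -> Prop :=
| smooth_closure_smooth F of smooth U F : smooth_closure F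
| smooth_closure_cst k : smooth_closure (cst k)
| smooth_closureD F G of smooth_closure F & smooth_closure G :
    smooth_closure (F + G)
| smooth_closureM F G of smooth_closure F & smooth_closure G :
    smooth_closure (F * G)
| smooth_closureV F of smooth_closure F & (forall z, U z -> F z != 0) :
    smooth_closure (fun z => (F z)^-1).

Lemma smooth_closureP F : smooth_closure F -> smooth U F.
Proof.
have dS G : smooth_closure G -> forall z, U z -> differentiable G z.
  elim=> {G} [G sG|k|F' G _ dF _ dG|F' G _ dF _ dG|G _ dG G0] z Uz //.
  - exact: smooth_differentiable sG Uz.
  - by apply: differentiableD; [exact: dF|exact: dG].
  - by apply: differentiableM; [exact: dF|exact: dG].
  - by apply: differentiableV; [exact: dG|exact: G0].
apply: smooth_coind => // {}F v.
elim=> {F} [G sG|k|F G sF [F' sF' FE] sG [G' sG' GE]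
           |F G sF [F' sF' FE] sG [G' sG' GE]|G sG [G' sG' GE] G0].
- by exists ('D_v G) => //; constructor; exact: smooth_derive.
- by exists (cst 0) => [|z _]; [constructor|rewrite derive_cst].
- exists (F' + G') => [|z Uz]; first by constructor.
  by rewrite deriveD ?FE ?GE //; apply: diff_derivable; apply: dS.
- exists (F * G' + G * F') => [|z Uz]; first by do 2!constructor.
  by rewrite deriveM ?FE ?GE //; apply: diff_derivable; apply: dS.
- exists (cst (-1) * ((fun z => (G z)^-1) * (fun z => (G z)^-1)) * G') => [|z Uz].
    by do 3?constructor=> //; constructor.
  rewrite deriveV ?GE ?G0 //; last by apply: diff_derivable; apply: dS.
  by rewrite expr2 invfM mulN1r.
Qed.

Lemma smooth_closure_sum n (F : 'I_n -> E -> R) :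
  (forall i, smooth_closure (F i)) -> smooth_closure (\sum_i F i).
Proof.
move=> sF; elim/big_ind: _ => // [|G H]; last by constructor.
exact: (smooth_closure_cst 0).
Qed.

Lemma differentiable_rV n (F : E -> 'rV[R]_n) z :
  (forall j, differentiable (fun w => F w 0 j : R) z) -> differentiable F z.
Proof.
move=> dF; have -> : F = \sum_j (fun w => F w 0 j *: delta_mx 0 j).
  by apply/funext=> w; rewrite {1}[F w]row_sum_delta fct_sumE.
by apply: differentiable_sum => j; exact: differentiableZl.
Qed.

Lemma differentiable_coord_rV n (F : E -> 'rV[R]_n) z j :
  differentiable F z -> differentiable (fun w => F w 0 j : R) z.
Proof.
move=> dF.
exact: (@differentiable_comp _ _ _ _ F (fun M : 'rV[R]_n => M 0 j)
  _ dF (differentiable_coord _ _ _)).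
Qed.

Lemma derive_rV n (F : E -> 'rV[R]_n) z v j : differentiable F z ->
  ('D_v F z) 0 j = 'D_v (fun w => F w 0 j : R) z.
Proof. by move=> dF; rewrite derive_mx ?mxE //; exact: diff_derivable. Qed.

(** Both directions are instances of [smooth_coind]: one for the class of coordinates of smooth
    maps, the other for the class of maps with smooth coordinates. *)
Lemma smooth_rVP n (F : E -> 'rV[R]_n) :
  smooth U F <-> forall j, smooth U (fun w => F w 0 j : R).
Proof.
split=> [sF j|sF].
  apply: (@smooth_coind _ (fun G => exists2 H : E -> 'rV[R]_n, smooth U H &
      G = fun w => H w 0 j)); last by exists F.
    move=> _ [H sH ->] z Uz; apply: differentiable_coord_rV.
    exact: smooth_differentiable sH Uz.
  move=> _ v [H sH ->]; exists (fun w => 'D_v H w 0 j).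
    by exists ('D_v H) => //; exact: smooth_derive.
  by move=> z Uz; rewrite derive_rV //; exact: smooth_differentiable sH Uz.
apply: (smooth_coind (P := fun G : E -> 'rV[R]_n =>
    forall j, smooth U (fun w => G w 0 j : R)) _ _ sF).
  move=> G sG z Uz; apply: differentiable_rV => j.
  exact: smooth_differentiable (sG j) Uz.
move=> G v sG; exists (fun z => \row_j 'D_v (fun w => G w 0 j : R) z).
  move=> j; have := smooth_derive v (sG j); congr (smooth _ _).
  by apply/funext => w; rewrite mxE.
move=> z Uz; apply/rowP=> j; rewrite mxE derive_rV //.
by apply: differentiable_rV => k; exact: smooth_differentiable (sG k) Uz.
Qed.

End SmoothFunctions.

(** * Constancy of maps with zero differential on a ball *)

Section ZeroDifferential.
Variables (R : realType) (E : normedModType R).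

(** The segment from [z0] to [z] stays in the ball, and the mean value theorem applies to each
    coordinate of [F] along it. *)
Lemma ball_derive0_const (n : nat) (F : E -> 'rV[R]_n) z0 (e : R) :
  (forall z, ball z0 e z -> differentiable F z) ->
  (forall z v, ball z0 e z -> 'D_v F z = 0) ->
  forall z, ball z0 e z -> F z = F z0.
Proof.
move=> dF F0 z z0z; apply/rowP=> j.
pose w := z - z0.
pose gamma : R -> E := cst z0 + *:%R ^~ w.
pose phi : R -> R := (fun y => F y 0 j) \o gamma.
have path (t : R) : t \in `[0, 1] -> ball z0 e (gamma t).
  rewrite in_itv /= => /andP[t0 t1]; move: z0z; rewrite -!ball_normE /= => z0z.
  rewrite opprD addrA subrr sub0r normrN normrZ ger0_norm //.
  by apply: le_lt_trans (ler_piMl _ _) _ => //; rewrite distrC.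
have dphi (t : R) : t \in `[0, 1] -> is_derive t 1 phi 0.
  move=> /path gt.
  have dg : differentiable gamma t by apply: differentiableD.
  have dFj : differentiable (fun y => F y 0 j : R) (gamma t).
    exact/differentiable_coord_rV/dF.
  have dp : differentiable phi t by exact: differentiable_comp.
  apply: DeriveDef; first exact: diff_derivable.
  rewrite deriveE // diff_comp //= -deriveE // -derive_rV; last exact: dF.
  by rewrite F0 // mxE.
have phi_cont : {within `[0, 1], continuous phi}.
  by apply: derivable_within_continuous => t /dphi.
have phi0 (t : R) : t \in `]0, 1[ -> is_derive t 1 phi (cst 0 t).
  by move=> t01; apply: dphi; exact: subset_itv_oo_cc t01.
have [c _ /eqP] := MVT ltr01 phi0 phi_cont.
rewrite mul0r subr_eq0 => /eqP.
by rewrite /phi /= /gamma !fctE scale0r scale1r addr0 /w addrC subrK.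
Qed.

End ZeroDifferential.

(** * The inversion v |-> (r v)^-1 and its derivative *)

Section Inversion.
Variables (R : realType) (E : normedModType R) (n : nat).
Implicit Types (G : E -> 'rV[R]_n) (r : R).

(** For nonzero r and v this vector is the Clifford inverse of r v, because v v = -|v|^2. *)
Definition clifford_inv (r : R) (v : 'rV[R]_n) := - (r * dot v v)^-1 *: v.

Lemma cvec_clifford_inv r (v : 'rV[R]_n) : r != 0 -> v != 0 ->
  (r *: cvec v)^-1 = cvec (clifford_inv r v).
Proof.
move=> r0 v0; have [_ vV] := cvec_inv v0.
by rewrite invrZ ?unitfE // ?(cvec_inv v0).1 // vV cvecZ scalerA mulrN invfM.
Qed.

Lemma clifford_inv_eq0 r (v : 'rV[R]_n) : r != 0 -> v != 0 ->
  clifford_inv r v != 0.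
Proof.
move=> r0 v0; rewrite scaler_eq0 oppr_eq0 invr_eq0 mulf_eq0 dot_eq0.
by rewrite (negbTE r0) (negbTE v0).
Qed.

(** For v = g, u = df, w = dfc the argument of the outer [refl] on the left is dg, so the left side
    is dk for k = (r g)^-1. Two reflections in g give |g|^4, which turns r g dfc g into -dfc. *)
Lemma riccati_clifford_inv r (u v w : 'rV[R]_n) : r != 0 -> v != 0 ->
  - (r * dot v v ^+ 2)^-1 *: refl v (r *: refl v w - u) =
  (r * dot v v ^+ 2)^-1 *: refl v u - w.
Proof.
rewrite -dot_eq0 => r0 v0.
have reflN : refl v (- u) = - refl v u by rewrite -scaleN1r reflZ scaleN1r.
have c0 : r * dot v v ^+ 2 != 0 by rewrite mulf_neq0 // expf_neq0.
rewrite refl_linear reflK reflN scalerA scaleNr scalerBr scalerA.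
by rewrite mulVf // scale1r opprB.
Qed.

(** [refl] is quadratic in its first argument, so the factor -(r |v|^2)^-1 of the inverse enters
    squared. *)
Lemma cvec_refl_clifford_inv r (v w : 'rV[R]_n) : r != 0 -> v != 0 ->
  r *: (cvec (clifford_inv r v) * cvec w * cvec (clifford_inv r v)) =
  cvec ((r * dot v v ^+ 2)^-1 *: refl v w).
Proof.
rewrite -dot_eq0 => r0 v0; rewrite -cvec_refl -cvecZ reflZl scalerA.
by congr (cvec (_ *: _)); field; rewrite r0 v0.
Qed.

Lemma smooth_clifford_inv r G U : open U -> r != 0 ->
  (forall z, U z -> G z != 0) -> smooth U G ->
  smooth U (fun z => clifford_inv r (G z)).
Proof.
move=> oU r0 G0 sG; apply/smooth_rVP => // j; apply: smooth_closureP => //.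
have sGi i : smooth_closure U (fun w => G w 0 i : R).
  by constructor; move/smooth_rVP: sG; apply.
pose q := \sum_i ((fun w => G w 0 i : R) * (fun w => G w 0 i)).
have -> : (fun w => clifford_inv r (G w) 0 j) =
    cst (-1) * (fun w => ((cst r * q) w)^-1) * (fun w => G w 0 j).
  by apply/funext => w; rewrite !fctE mxE /q fct_sumE mulN1r.
do 2?apply: smooth_closureM => //; first exact: smooth_closure_cst.
apply: smooth_closureV => [|z Uz].
  apply: smooth_closureM; first exact: smooth_closure_cst.
  by apply: smooth_closure_sum => i; exact: smooth_closureM.
rewrite !fctE /q fct_sumE mulf_neq0 //.
by have := G0 z Uz; rewrite -dot_eq0.
Qed.

(** In Clifford terms this is d((r g)^-1) = - r^-1 g^-1 dg g^-1; it is computed coordinatewise by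
    the quotient rule. *)
Lemma derive_clifford_inv r G z v : r != 0 -> G z != 0 ->
  differentiable G z ->
  'D_v (fun z => clifford_inv r (G z)) z =
  - (r * dot (G z) (G z) ^+ 2)^-1 *: refl (G z) ('D_v G z).
Proof.
move=> r0 G0 dG.
have Gi i : is_derive z v (fun w => G w 0 i : R) ('D_v G z 0 i).
  rewrite derive_rV //; apply: derivableP; apply: diff_derivable.
  exact: differentiable_coord_rV.
pose q := \sum_i ((fun w => G w 0 i : R) * (fun w => G w 0 i)).
have qE w : q w = dot (G w) (G w) by rewrite /q fct_sumE.
have q0 : q z != 0 by rewrite qE dot_eq0.
have dq : is_derive z v q (2 * dot (G z) ('D_v G z)).
  apply: is_derive_eq; rewrite /dot mulr_sumr; apply: eq_bigr => i _.
  by rewrite /GRing.scale /=; ring.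
have drq : is_derive z v (fun w => (r * q w)^-1)
    (- (r * q z) ^- 2 * (r * (2 * dot (G z) ('D_v G z)))).
  have d : is_derive z v (cst r * q) (r * (2 * dot (G z) ('D_v G z))).
    by apply: is_derive_eq; rewrite scaler0 addr0.
  apply: DeriveDef; first by apply: derivableV; rewrite ?mulf_neq0.
  by rewrite deriveV ?mulf_neq0 // derive_val.
have dK j : is_derive z v (fun w => clifford_inv r (G w) 0 j : R)
    ((- (r * dot (G z) (G z) ^+ 2)^-1 *: refl (G z) ('D_v G z)) 0 j).
  have -> : (fun w => clifford_inv r (G w) 0 j) =
      - ((fun w => (r * q w)^-1) * (fun w => G w 0 j)).
    by apply/funext=> w; rewrite !fctE mxE qE mulNr.
  apply: is_derive_eq; rewrite /refl !mxE !qE /GRing.scale /=.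
  by move: G0; rewrite -dot_eq0 => G0; field; rewrite r0 G0.
rewrite derive_mx; last first.
  by apply/derivable_mxP => i j; rewrite ord1; apply: ex_derive.
by apply/rowP=> j; rewrite mxE; apply: derive_val.
Qed.

Lemma diff_clifford_inv r G z X : r != 0 -> G z != 0 ->
  differentiable G z -> differentiable (fun w => clifford_inv r (G w)) z ->
  'd (fun w => clifford_inv r (G w)) z X =
  - (r * dot (G z) (G z) ^+ 2)^-1 *: refl (G z) ('d G z X).
Proof.
move=> r0 G0 dG dK; apply: etrans (esym (deriveE X dK)) _.
apply: etrans (derive_clifford_inv X r0 G0 dG) _.
by congr (_ *: refl _ _); exact: deriveE.
Qed.

End Inversion.

(** * Charts, their images in the real plane, and locally constant maps on the surface *)

Section Charts.
Variables (R : realType).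
Local Notation C := (R[i]%C^o).

(** A positive [e] in [R[i]] is real. The norm on the product is the maximum and on the complex
    numbers the Euclidean one, so a bound e/2 on each coordinate suffices. *)
Lemma plane_continuous : continuous (@plane R).
Proof.
move=> z; apply/cvgrPdist_lt => e; rewrite ltcE /= => /andP[/eqP e0 e1].
have e2 : 0 < complex.Re e / 2 by rewrite divr_gt0.
have -> : e = (complex.Re e)%:C%C by case: (e) e0 => x y /= ->.
near=> w.
have [/= zw1 zw2] : ball z (complex.Re e / 2) w.
  by near: w; exact: (nbhsx_ballx z).
have {}zw1 : `|z.1 - w.1| < complex.Re e / 2 := zw1.
have {}zw2 : `|z.2 - w.2| < complex.Re e / 2 := zw2.
rewrite normc_def ltcR /= -[ltRHS](gtr0_norm e1) -sqrtr_sqr.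
rewrite ltr_sqrt ?exprn_gt0 //.
move: zw1 zw2; rewrite !ltr_norml => /andP[a1 a2] /andP[b1 b2].
by nra.
Unshelve. all: by end_near. Qed.

Lemma open_plane (A : set C) : open A -> open (@plane R @^-1` A).
Proof. by move=> oA; apply: open_comp => // z _; exact: plane_continuous. Qed.

Lemma nbhs_ReIm (z : C) (A : set (R * R)) :
  nbhs (complex.Re z, complex.Im z) A ->
  \forall w \near z, A (complex.Re w, complex.Im w).
Proof.
move=> /nbhs_ballP[e /= e0 eA].
have eC : 0 < e%:C%C by rewrite ltcR.
apply: filterS (nbhsx_ballx z _ eC) => w zw; apply: eA.
move: zw; rewrite -ball_normE /= => zw.
suff [xy1 xy2] : `|complex.Re z - complex.Re w| < e /\
    `|complex.Im z - complex.Im w| < e by [].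
split; rewrite -ltcR; apply: le_lt_trans zw.
  by have := normc_ge_Re (z - w); rewrite raddfB.
(* The bound on the imaginary part comes from the one on real parts, since Re (x i) = - Im x. *)
have := normc_ge_Re ((z - w) * 'i%C).
by rewrite ReiNIm normrN normrM complexiE normCi mulr1 raddfB.
Qed.

Variables (M : riemann_surface R).

Definition chart_image (c : chart R M) (W : set M) : set (R * R) :=
  [set z | exists2 p, dom c p /\ W p & xy c p = z].

Lemma plane_xy (c : chart R M) p : plane (xy c p) = Defs.coord c p.
Proof. by rewrite /plane /xy /=; case: (Defs.coord c p). Qed.

Lemma local_xy n (c : chart R M) (f : M -> 'rV[R]_n) p : is_chart c -> dom c p ->
  local c f (xy c p) = f p.
Proof. by case=> _ _ _ _ K cp; rewrite /local /= plane_xy K. Qed.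

(** The image is the part of the open coordinate domain that the continuous [param c] sends into
    [W]. *)
Lemma open_chart_image (c : chart R M) (W : set M) :
  is_chart c -> open W -> open (chart_image c W).
Proof.
move=> [od oi cc pc K] oW.
have -> : chart_image c W =
    @plane R @^-1` [set z | (Defs.coord c @` dom c) z /\ W (param c z)].
  apply/seteqP; split=> [_ [p [cp Wp] <-]|z [[p cp pz] Wz]] /=.
    by rewrite plane_xy K //; split=> //; exists p.
  exists p; first by move: Wz; rewrite -pz K.
  by rewrite /xy pz; case: (z).
apply: open_plane; rewrite openE => z [Bz Wz]; apply: filterI.
  exact: open_nbhs_nbhs.
have : {for z, continuous (param c)}.
  move: pc; rewrite continuous_open_subspace // => pc; apply: pc; exact: mem_set.
by apply; exact: open_nbhs_nbhs.
Qed.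

Lemma near_xy (c : chart R M) p (A : set (R * R)) :
  is_chart c -> dom c p -> nbhs (xy c p) A ->
  \forall q \near p, A (xy c q).
Proof.
move=> [od oi cc pc K] cp /nbhs_ReIm Ap.
have cp_cont : {for p, continuous (Defs.coord c)}.
  move: cc; rewrite continuous_open_subspace // => cc; apply: cc; exact: mem_set.
exact: cp_cont Ap.
Qed.

Variable n : nat.
Implicit Types (f u : M -> 'rV[R]_n) (W : set M) (c : chart R M).

Lemma smooth_onP W f :
  smooth_on W f <-> forall c, atlas c -> smooth (chart_image c W) (local c f).
Proof.
split=> [sf c Ac vs z [p [cp Wp] <-]|sf c Ac vs p cp Wp]; first exact: sf.
by apply: sf => //; exists p.
Qed.

Lemma smooth_onW W W' f : W `<=` W' -> smooth_on W' f -> smooth_on W f.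
Proof. by move=> WW' sf c Ac vs p cp /WW'; exact: sf. Qed.

Lemma smooth_on_differentiable W f c p : smooth_on W f -> atlas c -> dom c p ->
  W p -> differentiable (local c f) (xy c p).
Proof. by move=> sf Ac cp Wp; exact: (sf c Ac [::]). Qed.

Lemma locally_const W u : open W ->
  (forall c p, atlas c -> dom c p -> W p ->
    differentiable (local c u) (xy c p) /\ forall X, diff_at c u p X = 0) ->
  forall p, W p -> \forall q \near p, u q = u p.
Proof.
move=> oW du p Wp; have [c Ac cp] := atlas_cover p.
have isc := atlas_chart Ac.
have Ip : chart_image c W (xy c p) by exists p.
have /nbhs_ballP[e /= e0 eI] :=
  open_nbhs_nbhs (conj (open_chart_image isc oW) Ip).
have uconst := @ball_derive0_const _ _ _ (local c u) (xy c p) e _ _.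
have [od _ _ _ _] := isc.
near=> q.
have cq : dom c q by near: q; exact: open_nbhs_nbhs.
rewrite -[u q](local_xy _ isc cq) -[u p](local_xy _ isc cp).
apply: uconst => [z /eI [q' [cq' Wq'] <-]|z v /eI [q' [cq' Wq'] <-]|].
- by have [] := du _ _ Ac cq' Wq'.
- by have [d d0] := du _ _ Ac cq' Wq'; rewrite deriveE //; exact: d0.
- by near: q; apply: (near_xy isc cp); exact: nbhsx_ballx.
Unshelve. all: by end_near. Qed.

Lemma connected_const W u : open W -> connected W ->
  (forall p, W p -> \forall q \near p, u q = u p) ->
  forall p q, W p -> W q -> u p = u q.
Proof.
move=> oW cW uW p q Wp Wq.
(* Local constancy makes the preimage of any set of values open. Used for a single value and for its
   complement, this makes a level set both open and closed in [W]. *)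
have oC (P : set 'rV[R]_n) : open [set q | W q /\ P (u q)].
  rewrite openE => q' [Wq' Pq']; apply: filterI; first exact: open_nbhs_nbhs.
  by apply: filterS (uW _ Wq') => x ->.
suff WE : [set q | W q /\ u q = u p] = W by move: Wq; rewrite -WE => -[].
apply: cW; first by exists p.
- exists [set q | W q /\ u q = u p]; first exact: (oC [set x | x = u p]).
  by apply/seteqP; split=> [x [? ?]|x [? []]].
- exists (~` [set q | W q /\ u q <> u p]).
    exact/open_closedC/(oC [set x | x <> u p]).
  apply/seteqP; split=> [x [Wx ux]|x [Wx ux]]; split=> //=; first by case.
  by apply: contrapT => nux; apply: ux.
Qed.

End Charts.

(** * Linear algebra of the Christoffel equations at one point *)

Section PointwisePairs.
Variables (R : realType) (n : nat).
Implicit Types (alpha beta : R * R -> 'rV[R]_n).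

Definition plane_linear alpha :=
  forall X, alpha X = X.1 *: alpha (1, 0) + X.2 *: alpha (0, 1).

Lemma plane_linearP (alpha : {linear (R * R)%type -> 'rV[R]_n}) :
  plane_linear alpha.
Proof.
move=> [x y]; rewrite -!linearZ -linearD /=; congr (alpha _).
apply/pair_equal_spec.
by split; rewrite /= /GRing.scale /= ?mulr1 ?mulr0 ?addr0 ?add0r.
Qed.

(** This expands (a1 - i a2, b1 - i b2) / 4 into real and imaginary parts. *)
Lemma part20E alpha beta :
  let: (a1, a2) := (alpha (1, 0), alpha (0, 1)) in
  let: (b1, b2) := (beta (1, 0), beta (0, 1)) in
  part20 alpha beta =
  ((dot a1 b1 - dot a2 b2) +i* - (dot a1 b2 + dot a2 b1))%C / 4.
Proof.
rewrite /part20 /dot -!sumrB -!big_split -sumrN /=.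
have csum (x y : 'I_n -> R) :
    ((\sum_i x i) +i* (\sum_i y i))%C = \sum_i (x i +i* y i)%C.
  elim/big_ind3: _ => // x1 y1 z1 x2 y2 z2 <- <-; exact: erefl.
rewrite csum mulr_suml; apply: eq_bigr => i _; rewrite !mxE.
rewrite mulrACA -invfM -natrM; congr (_ / _).
apply/eqP; rewrite eq_complex /=; apply/andP; split; apply/eqP; ring.
Qed.

(** The forms trade places under the reflection, so the product of the values of alpha' and beta'
    involves beta before alpha; [cvecM_rev] supplies the reversed identity. *)
Lemma wedge_refl alpha beta alpha' beta' g (k k' : R) :
  (forall X Y, wedge (@cvec R n \o alpha) (@cvec R n \o beta) X Y = 0) ->
  (forall X, alpha' X = k *: refl g (beta X)) ->
  (forall X, beta' X = k' *: refl g (alpha X)) ->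
  forall X Y, wedge (@cvec R n \o alpha') (@cvec R n \o beta') X Y = 0.
Proof.
move=> w0 aE bE X Y; rewrite /wedge /= !aE !bE !cvecZ -!scalerAl -!scalerAr.
have /eqP := w0 X Y; rewrite subr_eq0 => /eqP /= w0XY.
by rewrite !cvecM_refl -(cvecM_rev w0XY) subrr.
Qed.

Lemma conformal_pair alpha beta (lambda : R) : plane_linear alpha ->
  injective alpha ->
  (forall X Y, dot (alpha X) (alpha Y) = lambda * (X.1 * Y.1 + X.2 * Y.2)) ->
  (forall X Y, wedge (@cvec R n \o alpha) (@cvec R n \o beta) X Y = 0) ->
  let: (a, b) := (alpha (1, 0), alpha (0, 1)) in
  exists s m,
  [/\ lambda != 0,
      lambda *: beta (1, 0) = s *: a + m *: b,
      lambda *: beta (0, 1) = m *: a - s *: b &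
      part20 alpha beta = (s +i* - m)%C / 2].
Proof.
move=> la ia conf w0.
have aa : dot (alpha (1, 0)) (alpha (1, 0)) = lambda by rewrite conf /=; ring.
have bb : dot (alpha (0, 1)) (alpha (0, 1)) = lambda by rewrite conf /=; ring.
have ab : dot (alpha (1, 0)) (alpha (0, 1)) = 0 by rewrite conf /=; ring.
have l0 : lambda != 0.
  rewrite -aa dot_eq0; apply/eqP => a0.
  have : alpha (1, 0) = alpha (0, 0) by rewrite a0 la !scale0r addr0.
  by move=> /ia [] /eqP; rewrite oner_eq0.
have /eqP := w0 (1, 0) (0, 1); rewrite subr_eq0 => /eqP /= E.
have [e1 e2] := conformal_wedge0 l0 aa bb ab E.
exists (dot (alpha (1, 0)) (beta (1, 0))), (dot (alpha (1, 0)) (beta (0, 1))).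
split=> //.
(* Pairing the formula for beta (0, 1) with alpha (0, 1) gives this; the real part of the
   coefficient thereby becomes 2 s / 4. *)
have bd2 :
    dot (alpha (0, 1)) (beta (0, 1)) = - dot (alpha (1, 0)) (beta (1, 0)).
  apply: (mulfI l0); rewrite -dotZr e2 dotBr !dotZr bb.
  by rewrite (dotC (alpha (0, 1)) (alpha (1, 0))) ab; ring.
rewrite part20E bd2 -(cvecM_eq_dot E).
apply: (mulIf (_ : 4 != 0 :> R[i]%C)); first by rewrite pnatr_eq0.
have -> : (4 : R[i]%C) = 2 * 2 by rewrite -natrM.
rewrite divfK ?mulf_neq0 ?pnatr_eq0 // mulrA divfK ?pnatr_eq0 //.
rewrite -[2]/(1 + 1) mulrDr mulr1.
by apply/eqP; rewrite eq_complex /=; apply/andP; split; apply/eqP; ring.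
Qed.

(** In the orthogonal frame a, b the partial derivatives of beta have coefficients (s, m) and (m,
    -s) over lambda: orthogonal, and both of squared length (s^2 + m^2) / lambda. This is nonzero
    because the dz^2 coefficient is (s - i m) / 2. *)
Lemma conformal_pair_conformal alpha beta (lambda : R) :
  plane_linear alpha -> plane_linear beta -> injective alpha ->
  (forall X Y, dot (alpha X) (alpha Y) = lambda * (X.1 * Y.1 + X.2 * Y.2)) ->
  (forall X Y, wedge (@cvec R n \o alpha) (@cvec R n \o beta) X Y = 0) ->
  part20 alpha beta != 0 ->
  exists2 mu, mu != 0 &
    forall X Y, dot (beta X) (beta Y) = mu * (X.1 * Y.1 + X.2 * Y.2).
Proof.
move=> la lb ia conf w0.
have [s [m [l0 e1 e2 ->]]] := conformal_pair la ia conf w0 => q0.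
exists ((s ^+ 2 + m ^+ 2) / lambda).
  rewrite mulf_neq0 ?invr_eq0 // paddr_eq0 ?sqr_ge0 // !expf_eq0 /=.
  apply: contra q0 => /andP[/eqP -> /eqP ->]; rewrite mulf_eq0; apply/orP; left.
  by rewrite eq_complex /= oppr0 eqxx.
have b1 : beta (1, 0) = lambda^-1 *: (s *: alpha (1, 0) + m *: alpha (0, 1)).
  by rewrite -e1 scalerA mulVf // scale1r.
have b2 : beta (0, 1) = lambda^-1 *: (m *: alpha (1, 0) - s *: alpha (0, 1)).
  by rewrite -e2 scalerA mulVf // scale1r.
move=> X Y; rewrite (lb X) (lb Y) b1 b2.
rewrite !(dotDl, dotDr, dotZl, dotZr, dotNl, dotNr, conf) /=.
by field.
Qed.

(** The dz^2 coefficient recovers s and m as its real and imaginary parts up to constants, and these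
    fix both partial derivatives. *)
Lemma conformal_pair_unique alpha beta beta' (lambda : R) :
  plane_linear alpha -> plane_linear beta -> plane_linear beta' ->
  injective alpha ->
  (forall X Y, dot (alpha X) (alpha Y) = lambda * (X.1 * Y.1 + X.2 * Y.2)) ->
  (forall X Y, wedge (@cvec R n \o alpha) (@cvec R n \o beta) X Y = 0) ->
  (forall X Y, wedge (@cvec R n \o alpha) (@cvec R n \o beta') X Y = 0) ->
  part20 alpha beta = part20 alpha beta' ->
  forall X, beta X = beta' X.
Proof.
move=> la lb lb' ia conf w0 w0'.
have [s [m [l0 e1 e2 ->]]] := conformal_pair la ia conf w0.
have [s' [m' [_ e1' e2' ->]]] := conformal_pair la ia conf w0'.
have half0 : (2 : R[i]%C)^-1 != 0 by rewrite invr_eq0 pnatr_eq0.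
move=> /(mulIf half0) [ss /oppr_inj mm] X; rewrite lb lb'.
congr (_ *: _ + _ *: _).
  by apply: (scalerI l0); rewrite e1 e1' ss mm.
by apply: (scalerI l0); rewrite e2 e2' ss mm.
Qed.

(** Expanding the inner products gives |alpha X - alpha Y|^2 = mu |X - Y|^2. *)
Lemma conformal_injective alpha (mu : R) : mu != 0 ->
  (forall X Y, dot (alpha X) (alpha Y) = mu * (X.1 * Y.1 + X.2 * Y.2)) ->
  injective alpha.
Proof.
move=> mu0 conf X Y XY.
have : mu * ((X.1 - Y.1) ^+ 2 + (X.2 - Y.2) ^+ 2) = 0.
  transitivity (dot (alpha X - alpha Y) (alpha X - alpha Y)).
    by rewrite !(dotBl, dotBr, conf) /=; ring.
  by rewrite XY subrr dot0l.
move=> /eqP; rewrite mulf_eq0 (negbTE mu0) paddr_eq0 ?sqr_ge0 //.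
rewrite !sqrf_eq0 !subr_eq0.
by case: X Y {XY} => [x1 x2] [y1 y2] /= /andP[/eqP -> /eqP ->].
Qed.

(** [refl g] scales inner products by |g|^4, which k k' cancels, and the (2,0) part is symmetric in
    its two forms. *)
Lemma part20_refl alpha beta alpha' beta' g (k k' : R) :
  k * k' * dot g g ^+ 2 = 1 ->
  (forall X, alpha' X = k *: refl g (beta X)) ->
  (forall X, beta' X = k' *: refl g (alpha X)) ->
  part20 alpha' beta' = part20 alpha beta.
Proof.
move=> kk aE bE; rewrite !part20E.
have dE X Y : dot (alpha' X) (beta' Y) = dot (alpha Y) (beta X).
  by rewrite aE bE dotZl dotZr dot_refl mulrA (mulrA _ (_ ^+ 2)) kk mul1r dotC.
by rewrite !dE (addrC (dot (alpha (0, 1)) _)).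
Qed.

End PointwisePairs.

(** * Differentials and smoothness of sums and inverses in charts *)

Lemma eq_addl (R : realType) (n : nat) (u v w : 'rV[R]_n) :
  w = u + v -> u = w -> v = 0.
Proof. by move=> -> E; apply: (addrI u); rewrite addr0. Qed.

Lemma diffD_apply (R : realType) (E V : normedModType R) (F G H : E -> V) z :
  H = F + G -> differentiable F z -> differentiable G z ->
  forall X, 'd H z X = 'd F z X + 'd G z X.
Proof. by move=> -> dF dG X; rewrite (diffD dF dG). Qed.

Section Differentials.
Variables (R : realType) (M : riemann_surface R) (n : nat).
Implicit Types (f g : M -> 'rV[R]_n) (c : chart R M) (W : set M).

Lemma plane_linear_diff_at c f p : plane_linear (diff_at c f p).
Proof. exact: plane_linearP. Qed.

Lemma diff_atD c f g h p : (forall q, h q = f q + g q) ->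
  differentiable (local c f) (xy c p) -> differentiable (local c g) (xy c p) ->
  forall X, diff_at c h p X = diff_at c f p X + diff_at c g p X.
Proof.
move=> hE df dg; have hfg : local c h = local c f + local c g.
  by apply/funext => z; rewrite /local /= hE.
exact: (diffD_apply hfg df dg).
Qed.

Lemma smooth_onD W f g h : open W -> (forall q, h q = f q + g q) ->
  smooth_on W f -> smooth_on W g -> smooth_on W h.
Proof.
move=> oW hE /smooth_onP sf /smooth_onP sg; apply/smooth_onP => c Ac.
have oI := open_chart_image (atlas_chart Ac) oW.
apply/smooth_rVP => // j; apply: smooth_closureP => //.
have -> : (fun w => local c h w 0 j) =
    (fun w => local c f w 0 j) + (fun w => local c g w 0 j).
  by apply/funext => z; rewrite /local /= hE mxE.
by do 2!constructor; move: j; apply/smooth_rVP => //; [exact: sf|exact: sg].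
Qed.

Lemma diff_at_clifford_inv c g p r X : r != 0 -> is_chart c -> dom c p ->
  g p != 0 -> differentiable (local c g) (xy c p) ->
  differentiable (local c (fun q => clifford_inv r (g q))) (xy c p) ->
  diff_at c (fun q => clifford_inv r (g q)) p X =
  - (r * dot (g p) (g p) ^+ 2)^-1 *: refl (g p) (diff_at c g p X).
Proof.
move=> r0 isc cp g0 dg dk; have gE := local_xy g isc cp.
have g0' : local c g (xy c p) != 0 by rewrite gE.
have := diff_clifford_inv X r0 g0' dg dk.
by rewrite gE.
Qed.

Lemma smooth_on_clifford_inv W g r : open W -> r != 0 -> (forall p, g p != 0) ->
  smooth_on W g -> smooth_on W (fun q => clifford_inv r (g q)).
Proof.
move=> oW r0 g0 /smooth_onP sg; apply/smooth_onP => c Ac.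
have := sg c Ac; apply: smooth_clifford_inv => //.
  exact: open_chart_image (atlas_chart Ac) oW.
by move=> z _; exact: g0.
Qed.

End Differentials.

(** * Commutation of the Christoffel and Darboux transforms *)

Theorem theorem2p8 (R : realType) (n : nat) (M : riemann_surface R)
    (Q : quadratic_differential M) (Q0 : qnonzero Q)
    (f fc : M -> 'rV[R]_n)
    (f_isothermic : isothermic_on Q setT f)
    (f_fc : christoffel_pair_on Q setT f fc)
    (r : R) (r0 : r != 0)
    (g : M -> 'rV[R]_n) (g_darboux : darboux_solution r f fc g)
    (fhat : M -> 'rV[R]_n) (fhatE : forall p, fhat p = f p + g p) :
  exists h : M -> 'rV[R]_n,
    [/\ forall p, cvec (h p) = cvec (fc p) + (r *: cvec (g p))^-1,
        darboux_transform r fc f h,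
        isothermic_on Q (nonvanishing Q) fhat,
        christoffel_pair_on Q setT fhat h &
        forall (W : set M) (fhatc : M -> 'rV[R]_n),
          open W -> connected W -> W `<=` nonvanishing Q ->
          christoffel_pair_on Q W fhat fhatc ->
          exists v : 'rV[R]_n, forall p, W p -> fhatc p = h p + v].
Proof.
have [[sf fconf] _] := f_isothermic; have [sfc fpair] := f_fc.
have [sg g0 dg] := g_darboux.
pose k p := clifford_inv r (g p); pose h p := fc p + k p.
have sk : smooth_on setT k by exact: smooth_on_clifford_inv openT r0 g0 sg.
have sh : smooth_on setT h by exact: (smooth_onD openT (fun=> erefl) sfc sk).
have sfhat : smooth_on setT fhat by exact: (smooth_onD openT fhatE sf sg).
have d (u : M -> 'rV[R]_n) c p : smooth_on setT u -> atlas c -> dom c p ->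
    differentiable (local c u) (xy c p).
  by move=> su Ac cp; exact: smooth_on_differentiable su Ac cp I.
have gE c p X : atlas c -> dom c p ->
    diff_at c g p X = r *: refl (g p) (diff_at c fc p X) - diff_at c f p X.
  move=> Ac cp; apply: cvec_inj.
  by rewrite (dg c p X Ac cp) cvecB cvecZ cvec_refl.
have fhatD c p X : atlas c -> dom c p ->
    diff_at c fhat p X = r *: refl (g p) (diff_at c fc p X).
  move=> Ac cp; rewrite (diff_atD fhatE (d _ _ _ sf Ac cp) (d _ _ _ sg Ac cp)).
  by rewrite gE // addrC subrK.
have kD c p X : atlas c -> dom c p -> diff_at c k p X =
    (r * dot (g p) (g p) ^+ 2)^-1 *: refl (g p) (diff_at c f p X) -
    diff_at c fc p X.
  move=> Ac cp; rewrite diff_at_clifford_inv //; [|exact: atlas_chart|exact: d..].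
  by rewrite gE // riccati_clifford_inv.
have hD c p X : atlas c -> dom c p -> diff_at c h p X =
    (r * dot (g p) (g p) ^+ 2)^-1 *: refl (g p) (diff_at c f p X).
  move=> Ac cp.
  rewrite (diff_atD (fun=> erefl) (d _ _ _ sfc Ac cp) (d _ _ _ sk Ac cp)).
  by rewrite kD // addrC subrK.
have gg0 p : dot (g p) (g p) != 0 by rewrite dot_eq0.
(* The scalar factors of d(fhat) and dh cancel the |g|^4 of the reflection, so the pair (fhat, h)
   keeps the same Q. *)
have kk p : r * (r * dot (g p) (g p) ^+ 2)^-1 * dot (g p) (g p) ^+ 2 = 1.
  by field; rewrite r0 gg0.
have fhat_h : christoffel_pair_on Q setT fhat h.
  split=> [|c p Ac cp _]; first exact: sh.
  have [w0 q] := fpair c p Ac cp I.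
  have fhatX X := fhatD c p X Ac cp; have hX X := hD c p X Ac cp.
  split; first exact: wedge_refl w0 fhatX hX.
  exact: etrans (part20_refl (kk p) fhatX hX) q.
have fhat_conf : conformal_immersion_on (nonvanishing Q) fhat.
  split=> [|c p Ac cp Wp]; first exact: smooth_onW sfhat.
  have [w0 q] := fpair c p Ac cp I; have [ia [l conf]] := fconf c p Ac cp I.
  (* Away from the zeros of Q the differential of fc is conformal and injective, and d(fhat) is its
     image under a scaled reflection. *)
  have q0 : part20 (diff_at c f p) (diff_at c fc p) != 0 by rewrite q; exact: Wp.
  have [mu mu0 fcconf] := conformal_pair_conformal (plane_linear_diff_at _ _ _)
    (plane_linear_diff_at _ _ _) ia conf w0 q0.
  (* The conformal factor of fc is multiplied by r^2 from the scalar and by |g|^4 from the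
     reflection. *)
  pose nu := r ^+ 2 * dot (g p) (g p) ^+ 2 * mu.
  have nuE X Y : dot (diff_at c fhat p X) (diff_at c fhat p Y) =
      nu * (X.1 * Y.1 + X.2 * Y.2).
    by rewrite !fhatD // dotZl dotZr dot_refl fcconf /nu; ring.
  split; last by exists nu.
  by apply: conformal_injective nuE; rewrite !mulf_neq0 ?expf_neq0.
exists h; split.
- by move=> p; rewrite cvecD cvec_clifford_inv.
- exists k; last by [].
  split; [exact: sk|by move=> p; exact: clifford_inv_eq0|move=> c p X Ac cp].
  have -> := kD c p X Ac cp.
  by rewrite cvecB -(cvec_refl_clifford_inv _ r0 (g0 p)).
- split; [exact: fhat_conf|exists h; split=> [|c p Ac cp _]].
    exact: smooth_onW sh.
  exact: fhat_h.2 c p Ac cp I.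
- exact: fhat_h.
- move=> W fhatc oW cW WQ [sfhatc fhat_fhatc].
  have [W0|/set0P[p0 Wp0]] := eqVneq W set0; first by exists 0 => p; rewrite W0.
  (* Both fhatc and h solve the Christoffel equations for fhat, which is a conformal immersion on
     [W]. Pointwise uniqueness gives du = 0, and connectedness makes u constant, equal to its value
     at [p0]. *)
  pose u p := fhatc p - h p.
  exists (u p0) => p Wp.
  suff -> : u p0 = u p by rewrite addrC subrK.
  apply: (connected_const oW cW) => //; apply: locally_const => // c q Ac cq Wq.
  have dfhatc := smooth_on_differentiable sfhatc Ac cq Wq.
  have hE q' : fhatc q' = h q' + u q' by rewrite addrC subrK.
  have du : differentiable (local c u) (xy c q).
    exact: differentiableB dfhatc (d _ _ _ sh Ac cq).
  split=> // X.
  have [ia [l conf]] := fhat_conf.2 c q Ac cq (WQ _ Wq).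
  have [w0 qE] := fhat_h.2 c q Ac cq I.
  have [w0' qE'] := fhat_fhatc c q Ac cq Wq.
  have E := conformal_pair_unique (plane_linear_diff_at c fhat q)
    (plane_linear_diff_at c h q) (plane_linear_diff_at c fhatc q)
    ia conf w0 w0' (etrans qE (esym qE')) X.
  have D := diff_atD hE (d _ _ _ sh Ac cq) du X.
  exact: eq_addl D E.
Qed.
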